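(* For all integers $p \geq q \geq 1$, $$\tfrac{1}{2}pq - 1 \leq \mathrm{tw}(L(K_{p,q})) \leq \mathrm{pw}(L(K_{p,q})).$$
   Context: $K_{p,q}$ is the complete bipartite graph with parts of sizes $p$ and $q$. The line graph $L(G)$ of a graph $G$ has vertex set $E(G)$, two distinct elements being adjacent if and only if the corresponding edges of $G$ share an endpoint. A tree decomposition of a graph $H$ is a (nonempty) tree $T$ together with a collection of subsets of $V(H)$ (bags) indexed by the nodes of $T$ such that: every vertex of $H$ is in at least one bag; for each vertex $v$ of $H$, the nodes whose bags contain $v$ induce a connected subtree of $T$; and for each edge of $H$ some bag contains both its endpoints. Its width is the size of the largest bag minus 1. The treewidth $\mathrm{tw}(H)$ is the minimum width of a tree decomposition of $H$; the pathwidth $\mathrm{pw}(H)$ is the minimum width over tree decompositions whose tree $T$ is a path. *)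

(* Defs.v *)
From mathcomp Require Import all_boot.
From mathcomp Require Import boolp.

Set Implicit Arguments.
Unset Strict Implicit.
Unset Printing Implicit Defensive.

Record sgraph := SGraph {
  vertex :> finType;
  adj : rel vertex;
  adj_sym : symmetric adj;
  adj_irrefl : irreflexive adj }.

Definition graph_iso (G H : sgraph) : Prop :=
  exists f : G -> H, bijective f /\ forall x y, adj (f x) (f y) = adj x y.

Section CompleteBipartite.
Variables p q : nat.

Definition Kpq_adj : rel ('I_p + 'I_q)%type := fun x y =>
  match x, y with
  | inl _, inr _ | inr _, inl _ => true
  | _, _ => false
  end.

Lemma Kpq_sym : symmetric Kpq_adj. Proof. by move=> [?|?] [?|?]. Qed.
Lemma Kpq_irrefl : irreflexive Kpq_adj. Proof. by case. Qed.

Definition complete_bipartite : sgraph := SGraph Kpq_sym Kpq_irrefl.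
End CompleteBipartite.

Section LineGraph.
Variable G : sgraph.

Definition edges : {set {set G}} :=
  [set e : {set G} | [exists x, exists y, adj x y && (e == [set x; y])]].

Definition line_adj : rel {e : {set G} | e \in edges} := fun e f =>
  (e != f) && (val e :&: val f != set0).

Lemma line_sym : symmetric line_adj.
Proof. by move=> e f; rewrite /line_adj eq_sym setIC. Qed.
Lemma line_irrefl : irreflexive line_adj.
Proof. by move=> e; rewrite /line_adj eqxx. Qed.

Definition line_graph : sgraph := SGraph line_sym line_irrefl.
End LineGraph.

(* The subgraph induced by A is connected; the empty set counts as connected. *)
Definition connected (G : sgraph) (A : {set G}) : Prop :=
  {in A &, forall x y, connect [rel a b | [&& a \in A, b \in A & adj a b]] x y}.

(* ucycle also accepts x :: y :: nil for an edge xy, so a graph cycle is a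
   duplicate-free cyclic sequence of at least three vertices. *)
Definition acyclic (G : sgraph) : Prop :=
  forall c : seq G, ucycle (@adj G) c -> size c <= 2.

Definition is_tree (T : sgraph) : Prop :=
  [/\ 0 < #|T|, connected [set: T] & acyclic T].

Section PathGraph.
Variable n : nat.

Definition path_adj : rel 'I_n := fun i j => (i.+1 == j) || (j.+1 == i).

Lemma path_sym : symmetric path_adj.
Proof. by move=> i j; rewrite /path_adj orbC. Qed.
Lemma path_irrefl : irreflexive path_adj.
Proof. by move=> i; rewrite /path_adj orbb gtn_eqF. Qed.

Definition path_graph : sgraph := SGraph path_sym path_irrefl.
End PathGraph.

Definition is_path (T : sgraph) : Prop := exists n, graph_iso T (path_graph n).

Section Decompositions.
Variable H : sgraph.

Definition tree_decomposition (T : sgraph) (B : T -> {set H}) : Prop :=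
  [/\ is_tree T,
      forall v : H, exists t : T, v \in B t,
      forall v : H, connected [set t | v \in B t] &
      forall u v : H, adj u v -> exists t : T, (u \in B t) && (v \in B t)].

(* When H has no vertices the truncated predecessor gives 0 instead of -1; for
   every other H the largest bag is nonempty and this is exact. *)
Definition width (T : sgraph) (B : T -> {set H}) : nat :=
  (\max_(t : T) #|B t|).-1.

Definition tree_width_value (k : nat) : Prop :=
  exists (T : sgraph) (B : T -> {set H}),
    tree_decomposition B /\ width B = k.

Definition path_width_value (k : nat) : Prop :=
  exists (T : sgraph) (B : T -> {set H}),
    [/\ is_path T, tree_decomposition B & width B = k].

Lemma path_width_value_trivial : path_width_value #|H|.-1.
Proof.
exists (path_graph 1), (fun=> setT); split.
- by exists 1, id; split=> //; exists id.
- have conn (A : {set path_graph 1}) : connected A.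
    by move=> x y _ _; rewrite (ord1 x) (ord1 y) connect0.
  split.
  + split; [by rewrite card_ord | exact: conn |].
    move=> c /andP[_ /card_uniqP <-]; rewrite (leq_trans (max_card _)) //.
    by rewrite card_ord.
  + by move=> v; exists ord0; rewrite inE.
  + by move=> v; exact: conn.
  + by move=> u v _; exists ord0; rewrite !inE.
- by rewrite /width big_ord_recl big_ord0 maxn0 cardsT.
Qed.

Lemma ex_tree_width_value : exists k, `[< tree_width_value k >].
Proof.
have [T [B [_ TB wB]]] := path_width_value_trivial.
by exists #|H|.-1; apply/asboolP; exists T, B.
Qed.

Lemma ex_path_width_value : exists k, `[< path_width_value k >].
Proof. by exists #|H|.-1; apply/asboolP; exact: path_width_value_trivial. Qed.

Definition treewidth : nat := ex_minn ex_tree_width_value.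
Definition pathwidth : nat := ex_minn ex_path_width_value.
End Decompositions.

(* Main.v *)
(* Suppose every bag of a tree decomposition of the p x q rook's graph has fewer
   than pq/2 cells.  Deleting a node t leaves components; all cells of a row (or
   column) outside the bag of t lie in one component, which we assign to that
   row (or column).  If a component C receives r_C rows and c_C columns, then
   the sum of r_C c_C exceeds pq/2, and AM-GM forces r_C / p + c_C / q > 1 for
   some C.  Let t point to its neighbour in that C.  As the tree is finite and
   acyclic, two adjacent nodes x and y point to each other.  The two sides of
   the edge xy are disjoint, so no row or column lies on both; hence the two
   weights, each exceeding 1, add up to at most 2, a contradiction. *)
Require Import Defs.
From mathcomp Require Import all_boot all_order all_algebra.
From mathcomp Require Import zify lra.
From mathcomp Require Import boolp.
Import Order.TTheory GRing.Theory Num.Theory.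

(** * Counting rows and columns by class *)

Lemma sum_card_fibers {I K : finType} (g : I -> option K) :
  \sum_c #|[set i | g i == Some c]| <= #|I|.
Proof.
under eq_bigr do rewrite -sum1dep_card big_mkcond.
rewrite exchange_big /= -sum1_card leq_sum // => i _.
case: (g i) => [c|]; last by rewrite big1.
rewrite (bigD1 c) //= eqxx big1 // => d; rewrite eq_sym => /negbTE.
by rewrite (inj_eq Some_inj) => ->.
Qed.

(** If no class were heavy, AM-GM would give 4 r_c s_c |I||J| <= (r_c |J| + s_c |I|)^2 <= |I||J|
    (r_c |J| + s_c |I|). Cancelling |I||J| and summing over c yields 4|D| <= 2|I||J|. *)
Lemma heavy_class {I J K : finType}
    (g : I -> option K) (h : J -> option K) (D : {set I * J}) :
  (forall i j, (i, j) \in D -> exists2 c, g i = Some c & h j = Some c) ->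
  #|I| * #|J| < 2 * #|D| ->
  exists c, #|I| * #|J| <
    #|[set i | g i == Some c]| * #|J| + #|[set j | h j == Some c]| * #|I|.
Proof.
set r := fun c => #|[set i | g i == Some c]|.
set s := fun c => #|[set j | h j == Some c]|.
move=> gh ltD; apply: contrapT => /forallNP light.
have leD : #|D| <= \sum_c r c * s c.
  under eq_bigr do rewrite -cardsX -sum1_card big_mkcond.
  rewrite exchange_big -sum1_card big_mkcond leq_sum //= => -[i j] _.
  case: ifP => // /gh[c gi hj].
  by rewrite (bigD1 c) //= !inE /= gi hj eqxx.
have leIJ : #|D| <= #|I| * #|J| by rewrite -card_prod max_card.
have mass : \sum_c (r c * #|J| + s c * #|I|) <= 2 * (#|I| * #|J|).
  rewrite big_split /= -!big_distrl /=.
  have /leq_mul/(_ (leqnn #|J|)) : \sum_c r c <= #|I| := sum_card_fibers g.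
  have /leq_mul/(_ (leqnn #|I|)) : \sum_c s c <= #|J| := sum_card_fibers h.
  by move=> sJ rI; rewrite mul2n -addnn {2}[#|I| * _]mulnC leq_add.
have amgm c : 4 * (r c * s c) <= r c * #|J| + s c * #|I|.
  have := light c => /negP; rewrite -leqNgt -/(r c) -/(s c) => le1.
  (* From |D| <= |I||J| < 2|D|. *)
  have m0 : 0 < #|I| * #|J| by lia.
  rewrite -(leq_pmul2l m0).
  apply: leq_trans (leq_mul le1 (leqnn _)).
  have := (nat_AGM2 (r c * #|J|) (s c * #|I|)).1; rewrite -mulnn.
  by apply: leq_trans; lia.
have : 4 * \sum_c r c * s c <= 2 * (#|I| * #|J|).
  by rewrite big_distrr; apply: leq_trans mass; apply: leq_sum => c _; exact: amgm.
lia.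
Qed.

(** * Deleting a node of a tree *)

Section Trees.
Context {T : sgraph}.

(** Deletion isolates [t] instead of shrinking the vertex type, so [t] remains as a component of its
    own. *)
Definition del (t : T) : rel T := [rel a b | [&& a != t, b != t & adj a b]].

Lemma connect_del_sym t : connect_sym (del t).
Proof. by apply: sym_connect_sym => a b; rewrite /del /= adj_sym andbCA. Qed.

Lemma connected_del (A : {set T}) t :
  connected A -> t \notin A -> {in A &, forall x y, connect (del t) x y}.
Proof.
move=> cA tA x y xA yA; apply: connect_sub (cA x y xA yA) => a b /= /and3P[aA bA ab].
apply: connect1; rewrite /del /= ab andbT.
by apply/andP; split; apply: contraNneq tA => <-.
Qed.

(** Take for [y] the second node of a duplicate-free path from [t] to [z]: the rest of that path
    never returns to [t]. *)
Lemma neighbour_del t z :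
  connected [set: T] -> z != t -> exists2 y, adj t y & connect (del t) y z.
Proof.
move=> cT zt; have /connectP[p0 p0P zE] := cT t z (in_setT _) (in_setT _).
have := zt; rewrite zE; case/shortenP: p0P => -[|y p] /=; first by rewrite eqxx.
rewrite !inE negb_or => /andP[/andP[_ ty] pp] /andP[/andP[nty tp] _] _ _.
exists y => //; apply/connectP; exists p => //.
have ny : y != t by rewrite eq_sym.
elim: p y {ty nty} ny pp tp => //= a p IH y ny /andP[/andP[_ ya] pp].
rewrite inE negb_or => /andP[nta tp]; have na : a != t by rewrite eq_sym.
have {}ya : adj y a by case/andP: ya.
by rewrite {1}/del /= ny na ya; apply: IH.
Qed.

(** Neither walk uses the edge [xy], so joined at [z] they contain a simple path from [y] to [x]
    avoiding it, which [xy] closes into a cycle. *)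
Lemma edge_sides_disjoint x y z : acyclic T -> adj x y ->
  connect (del x) y z -> connect (del y) x z -> False.
Proof.
move=> acT xy yz xz.
pose e := [rel a b : T |
  adj a b && ~~ ((a == x) && (b == y) || (a == y) && (b == x))].
have esym : symmetric e.
  by move=> a b /=; rewrite adj_sym orbC [(b == y) && _]andbC [(b == x) && _]andbC.
have cyz : connect e y z.
  apply: connect_sub yz => a b /= /and3P[/negbTE ax /negbTE bx ab].
  by apply: connect1; rewrite /= ab ax bx andbF.
have cxz : connect e x z.
  apply: connect_sub xz => a b /= /and3P[/negbTE ay /negbTE by_ ab].
  by apply: connect1; rewrite /= ab ay by_ andbF.
rewrite (sym_connect_sym esym) in cxz.
have /connectP[p0 p0P xE] := connect_trans cyz cxz.
(* Zero steps would mean x = y, and a single step would be the edge [xy] itself; hence the cycle has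
   at least three vertices. *)
case/shortenP: p0P xE => -[|a [|b p]] pP pU _ xE.
- by rewrite xE adj_irrefl in xy.
- by move: pP; rewrite /= xE /= !eqxx orbT andbF.
have : ucycle (@adj T) (y :: a :: b :: p).
  rewrite /ucycle pU andbT /= -cats1.
  have sub : subrel e (@adj T) by move=> c d /andP[].
  have := sub_path sub pP; rewrite /= => /and3P[-> -> bp].
  by rewrite cat_path bp /= andbT; rewrite xE /= in xy.
by move=> /acT.
Qed.

(** Iterating [f] ends in a periodic orbit, which is a cycle of the graph; acyclicity bounds its
    period by 2. *)
Lemma mutual_neighbours (f : T -> T) :
  0 < #|T| -> acyclic T -> (forall t, adj t (f t)) -> exists t, f (f t) = t.
Proof.
move=> /card_gt0P[t0 _] acT fadj.
have /trajectP[i ltin it0] := looping_order f t0.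
set n := order f t0 in ltin it0; pose x := iter i f t0.
have fx : iter (n - i.+1).+1 f x = x.
  by rewrite /x -iterD -[RHS]it0; congr (iter _ f t0); lia.
have cyc : fcycle f (orbit f x) by apply/(orbitPcycle 3 0); exists (n - i.+1).
have : ucycle (@adj T) (orbit f x).
  rewrite /ucycle orbit_uniq andbT; apply: sub_cycle cyc => a _ /eqP <-.
  exact: fadj.
move=> /acT; rewrite size_orbit; move/(orbitPcycle 0 4): cyc.
case: (order f x) (order_gt0 f x) => [|[|[|//]]] //= _ ffx _; exists x => //.
by rewrite !ffx.
Qed.

End Trees.

(** * Tree decompositions of a graph containing the rook's graph *)

Section Rook.
Variables (H : sgraph) (p q : nat) (e : 'I_p -> 'I_q -> H).
Hypothesis e_inj : forall i j i' j', e i j = e i' j' -> (i, j) = (i', j').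
Hypothesis e_row : forall i j j', j != j' -> adj (e i j) (e i j').
Hypothesis e_col : forall i i' j, i != i' -> adj (e i j) (e i' j).
Variables (T : sgraph) (B : T -> {set H}).
Hypothesis TB : tree_decomposition B.

Lemma tree_decomposition_bag v : exists t, v \in B t.
Proof. by case: TB. Qed.

(** When the bag of [t] misses [v], all nodes whose bags hold [v] lie in one component of [T]
    without [t]; [home v] stands for them. *)
Definition home v : T := xchoose (tree_decomposition_bag v).

Lemma homeP v : v \in B (home v).
Proof. exact: xchooseP (tree_decomposition_bag v). Qed.

Lemma connect_del_home t s v :
  v \notin B t -> v \in B s -> connect (del t) s (home v).
Proof.
move=> vt vs; have [_ _ cB _] := TB.
by apply: connected_del (cB v) _ _ _ _ _; rewrite inE // homeP.
Qed.

(** Equality is allowed because two cells picked from one row or column may coincide. *)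
Lemma common_bag u v : u = v \/ adj u v -> exists2 t, u \in B t & v \in B t.
Proof.
case=> [->|]; first by exists (home v); rewrite homeP.
by case: TB => _ _ _ ad /ad[t /andP[ut vt]]; exists t.
Qed.

Lemma row_cells i j j' : e i j = e i j' \/ adj (e i j) (e i j').
Proof. by have [->|/e_row] := eqVneq j j'; [left|right]. Qed.

Lemma col_cells i i' j : e i j = e i' j \/ adj (e i j) (e i' j).
Proof. by have [->|/e_col] := eqVneq i i'; [left|right]. Qed.

Lemma connect_homes t u v : u = v \/ adj u v -> u \notin B t -> v \notin B t ->
  connect (del t) (home u) (home v).
Proof.
move=> /common_bag[s us vs] ut vt; apply: (@connect_trans _ _ s).
  by rewrite connect_del_sym connect_del_home.
exact: connect_del_home.
Qed.

Definition on_side x y v := (v \notin B x) && connect (del x) y (home v).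
Definition row_side x y := [set i | [exists j, on_side x y (e i j)]].
Definition col_side x y := [set j | [exists i, on_side x y (e i j)]].

(** A node whose bag holds both [u] and [v] would lie on both sides of the edge [xy]. *)
Lemma on_side_disjoint x y u v : adj x y -> u = v \/ adj u v ->
  on_side x y u -> on_side y x v -> False.
Proof.
move=> xy /common_bag[s us vs] /andP[ux cu] /andP[vy cv].
have [[_ _ acT] _ _ _] := TB.
apply: (edge_sides_disjoint x y s acT xy).
  by apply: connect_trans cu _; rewrite connect_del_sym connect_del_home.
by apply: connect_trans cv _; rewrite connect_del_sym connect_del_home.
Qed.

Lemma heavy_neighbour t : 2 * #|B t| < p * q ->
  exists2 y, adj t y & p * q < #|row_side t y| * q + #|col_side t y| * p.
Proof.
move=> small.
pose comp v := fingraph.root (del t) (home v).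
(* [None] marks a row lying wholly in the bag of [t]; otherwise the cell picked is immaterial by
   [comp_eq]. *)
pose g i := omap (fun j => comp (e i j)) [pick j | e i j \notin B t].
pose h j := omap (fun i => comp (e i j)) [pick i | e i j \notin B t].
pose D := [set ij : 'I_p * 'I_q | e ij.1 ij.2 \notin B t].
have comp_eq u v : u = v \/ adj u v -> u \notin B t -> v \notin B t ->
    comp u = comp v.
  by move=> uv ut vt; apply/fingraph.rootP; [exact: connect_del_sym|exact: connect_homes].
have ghD i j : (i, j) \in D -> exists2 c, g i = Some c & h j = Some c.
  rewrite inE /= => ijt; exists (comp (e i j)); rewrite /g /h.
    case: pickP => [j' ij't|/(_ j)]; last by rewrite ijt.
    by congr Some; apply: comp_eq ij't ijt; exact: row_cells.
  case: pickP => [i' i'jt|/(_ i)]; last by rewrite ijt.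
  by congr Some; apply: comp_eq i'jt ijt; exact: col_cells.
(* Distinct cells are distinct vertices, so the bag covers fewer than half of them. *)
have cDB : #|~: D| <= #|B t|.
  rewrite -(card_in_imset (f := fun ij => e ij.1 ij.2) (D := ~: D)); last first.
    by move=> [i j] [i' j'] _ _ /e_inj.
  by apply/subset_leq_card/subsetP=> _ /imsetP[ij + ->]; rewrite !inE negbK.
have ltD : #|'I_p| * #|'I_q| < 2 * #|D|.
  have := cardsC D; rewrite card_prod !card_ord; lia.
have [c heavy] := heavy_class g h D ghD ltD; rewrite !card_ord in heavy.
have rowc i : g i = Some c -> exists2 j, e i j \notin B t & comp (e i j) = c.
  by rewrite /g; case: pickP => //= j ijt [<-]; exists j.
have colc j : h j = Some c -> exists2 i, e i j \notin B t & comp (e i j) = c.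
  by rewrite /h; case: pickP => //= i ijt [<-]; exists i.
(* A heavy class has positive weight, so some row or column was assigned to it; a cell of that line
   outside the bag locates the component. *)
have [v vt vc] : exists2 v, v \notin B t & comp v = c.
  have [|/set0Pn[i]] := eqVneq [set i | g i == Some c] set0; last first.
    by rewrite inE => /eqP/rowc[j ijt ijc]; exists (e i j).
  have [|/set0Pn[j]] := eqVneq [set j | h j == Some c] set0; last first.
    by rewrite inE => /eqP/colc[i ijt ijc]; exists (e i j).
  by move=> h0 g0; move: heavy; rewrite h0 g0 !cards0.
have [[_ cT _] _ _ _] := TB.
have hvt : home v != t by apply: contraNneq vt => <-; exact: homeP.
have [y ty yv] := neighbour_del t (home v) cT hvt.
have side u : u \notin B t -> comp u = c -> on_side t y u.
  move=> ut uc; rewrite /on_side ut /=; apply: connect_trans yv _.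
  by apply/(fingraph.rootP (connect_del_sym t)); rewrite -/(comp u) uc.
exists y => //; apply: leq_trans heavy _; apply: leq_add.
  rewrite leq_mul2r subset_leq_card ?orbT //; apply/subsetP=> i.
  rewrite !inE => /eqP/rowc[j ijt ijc]; apply/existsP; exists j; exact: side.
rewrite leq_mul2r subset_leq_card ?orbT //; apply/subsetP=> j.
rewrite !inE => /eqP/colc[i ijt ijc]; apply/existsP; exists i; exact: side.
Qed.

Lemma rook_large_bag : exists t, p * q <= 2 * #|B t|.
Proof.
apply: contrapT => /forallNP small.
have heavy t : exists y,
    adj t y && (p * q < #|row_side t y| * q + #|col_side t y| * p).
  have [|y ty yh] := heavy_neighbour t.
    by have /negP := small t; rewrite -ltnNge.
  by exists y; rewrite ty.
pose f t := xchoose (heavy t).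
have fP t : adj t (f t) /\
    p * q < #|row_side t (f t)| * q + #|col_side t (f t)| * p.
  exact/andP/(xchooseP (heavy t)).
have [[T0 _ acT] _ _ _] := TB.
have [x fx] := mutual_neighbours f T0 acT (fun t => (fP t).1).
have [xy hx] := fP x; have [_ hy] := fP (f x); rewrite fx in hy.
have rows : #|row_side x (f x)| + #|row_side (f x) x| <= p.
  rewrite -[leqRHS]card_ord -cardsUI.
  rewrite [_ :&: _](_ : _ = set0) ?cards0 ?addn0 ?max_card //.
  apply/setP=> i; rewrite !inE; apply/negP => /andP[/existsP[j sj] /existsP[j' sj']].
  exact: (on_side_disjoint _ _ _ _ xy (row_cells i j j') sj sj').
have cols : #|col_side x (f x)| + #|col_side (f x) x| <= q.
  rewrite -[leqRHS]card_ord -cardsUI.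
  rewrite [_ :&: _](_ : _ = set0) ?cards0 ?addn0 ?max_card //.
  apply/setP=> j; rewrite !inE; apply/negP => /andP[/existsP[i si] /existsP[i' si']].
  exact: (on_side_disjoint _ _ _ _ xy (col_cells i i' j) si si').
(* The two weights sum to more than 2pq by [hx] and [hy], but to at most 2pq by [rows] and
   [cols]. *)
nia.
Qed.

End Rook.

(** * The rook's graph inside the line graph *)

Section Cells.
Variables p q : nat.
Let K := complete_bipartite p q.

Lemma cell_edge (i : 'I_p) (j : 'I_q) : [set (inl i : K); inr j] \in edges K.
Proof.
by rewrite inE; apply/existsP; exists (inl i); apply/existsP; exists (inr j); rewrite eqxx.
Qed.

Definition cell i j : line_graph K := exist (fun x => x \in edges K) _ (cell_edge i j).

Lemma cell_inj i j i' j' : cell i j = cell i' j' -> (i, j) = (i', j').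
Proof.
move=> /(congr1 val) /= /setP eqc.
have := eqc (inl i); have := eqc (inr j); rewrite !inE !eqxx orbT /=.
by move=> /esym/eqP[->] /esym; rewrite orbF => /eqP[->].
Qed.

Lemma cell_row i j j' : j != j' -> adj (cell i j) (cell i j').
Proof.
move=> jj'; apply/andP; split.
  by apply: contraNneq jj' => /cell_inj[->].
by apply/set0Pn; exists (inl i); rewrite !inE eqxx.
Qed.

Lemma cell_col i i' j : i != i' -> adj (cell i j) (cell i' j).
Proof.
move=> ii'; apply/andP; split.
  by apply: contraNneq ii' => /cell_inj[->].
by apply/set0Pn; exists (inr j); rewrite !inE eqxx !orbT.
Qed.

End Cells.

Lemma treewidthP (G : sgraph) : tree_width_value G (treewidth G).
Proof. by rewrite /treewidth; case: ex_minnP => k /asboolP. Qed.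

Lemma treewidth_le_pathwidth (G : sgraph) : treewidth G <= pathwidth G.
Proof.
rewrite /pathwidth; case: ex_minnP => k /asboolP[T [B [_ TB wB]]] _.
rewrite /treewidth; case: ex_minnP => l _; apply.
by apply/asboolP; exists T, B.
Qed.

Lemma treewidth_rook_ge (p q : nat) :
  p * q <= 2 * (treewidth (line_graph (complete_bipartite p q))).+1.
Proof.
have [T [B [TB <-]]] := treewidthP (line_graph (complete_bipartite p q)).
have [t big] := rook_large_bag _ _ _ _ (@cell_inj p q)
  (@cell_row p q) (@cell_col p q) _ _ TB.
apply: leq_trans big _; rewrite leq_mul2l /=.
(* [width] is a truncated predecessor; [leqSpred] bounds the largest bag by its successor even at
   0. *)
by apply: leq_trans (leqSpred _); apply: (leq_bigmax t).
Qed.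

Local Open Scope ring_scope.

Theorem theorem1p4 (p q : nat) (hq : (1 <= q)%N) (hpq : (q <= p)%N) :
  (1 / 2 * p%:R * q%:R - 1 <= (treewidth (line_graph (complete_bipartite p q)))%:R :> rat)
  /\ (treewidth (line_graph (complete_bipartite p q))
      <= pathwidth (line_graph (complete_bipartite p q)))%N.
Proof.
split; last exact: treewidth_le_pathwidth.
have := treewidth_rook_ge p q.
rewrite -(ler_nat rat) !natrM -(natr1 (treewidth _)); lra.
Qed.
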